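(* Let $X$ be a complete separable metric space with metric $d_X$, and let $f\colon X\to X$ be a continuous function. Suppose that the dynamical system $(X,f)$ is Li--Yorke chaotic, i.e., there is an uncountable scrambled set $Y\subseteq X$. Then there is a scrambled Cantor set $C\subseteq X$, i.e., a scrambled set $C \subseteq X$ that is homeomorphic to $2^{\mathbb{N}}$.
   Context: A dynamical system is a pair $(X,f)$ where $X$ is a metric space with metric $d_X$ and $f\colon X\to X$ is continuous; it is Polish if $X$ is complete and separable. Points $x,y\in X$ are proximal if $\liminf_{n\to\infty} d_X(f^n(x),f^n(y))=0$, and asymptotic if $\limsup_{n\to\infty} d_X(f^n(x),f^n(y))=0$. The pair $(x,y)$ is Li--Yorke if $x$ and $y$ are proximal but not asymptotic. A set $Y\subseteq X$ is scrambled if $(x,y)$ is Li--Yorke for all distinct $x,y\in Y$. The system $(X,f)$ is Li--Yorke chaotic if there is an uncountable scrambled set $Y\subseteq X$. A Cantor set is a homeomorphic copy of the Cantor space $2^{\mathbb{N}}$ (with the product topology). *)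

(* Defs.v *)
From mathcomp Require Import all_boot all_order all_algebra.
From mathcomp Require Import all_classical all_reals all_analysis.

Set Implicit Arguments.
Unset Strict Implicit.
Unset Printing Implicit Defensive.

Import Order.TTheory GRing.Theory Num.Theory.
Import numFieldNormedType.Exports.

Local Open Scope classical_set_scope.
Local Open Scope ring_scope.

(* Stated on sequences because the library's completeType also requires a
   distinguished point. *)
Definition complete_space (X : uniformType) : Prop :=
  forall u : nat -> X, cauchy (u @ \oo) -> exists l : X, u @ \oo --> l.

Definition separable_space (T : topologicalType) : Prop :=
  exists2 D : set T, countable D & dense D.

Definition homeomorphic (T U : topologicalType) : Prop :=
  exists (h : T -> U) (g : U -> T),
    [/\ cancel h g, cancel g h, continuous h & continuous g].

Section scrambled.
Context {R : realType} {X : metricType R}.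
Implicit Types (f : X -> X) (x y : X) (Y : set X).

(* Orbit distances may be unbounded, so their liminf and limsup are taken in
   the extended reals. *)
Definition orbit_dist f x y (n : nat) : \bar R :=
  (mdist (iter n f x) (iter n f y))%:E.

Definition proximal f x y : Prop := limn_einf (orbit_dist f x y) = 0%E.

Definition asymptotic f x y : Prop := limn_esup (orbit_dist f x y) = 0%E.

Definition li_yorke_pair f x y : Prop := proximal f x y /\ ~ asymptotic f x y.

Definition scrambled f Y : Prop :=
  forall x y, Y x -> Y y -> x <> y -> li_yorke_pair f x y.

Definition li_yorke_chaotic f : Prop :=
  exists2 Y : set X, ~ countable Y & scrambled f Y.

(* [set_type C] carries the topology induced from X. *)
Definition cantor_set (C : set X) : Prop :=
  homeomorphic (set_type C) cantor_space.

End scrambled.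

(* Main.v *)
(* Let rho(x, y) be the limsup of the orbit distances of x and y, so that a
   scrambled uncountable Y satisfies rho > 0 off the diagonal. For each k take a
   maximal subset D_k of Y whose points are pairwise at rho-distance > 1/(k+1).
   If some D_k is uncountable, being proximal with rho >= 1/(k+1) follows from a
   countable intersection of open conditions on pairs, and a Cantor scheme of
   uncountable subsets of D_k, split at condensation points, yields the Cantor
   set. Otherwise Y is rho-separable: every y in Y is determined up to rho = 0 by
   a choice of 1/(k+1)-close elements of the countable sets D_k. Recording these
   choices, together with times from which the closeness is witnessed, amounts
   to refining the topology so that rho > 0 becomes an open condition; the same
   scheme, now also fixing longer and longer initial segments of the records,
   applies. *)

Require Import Defs.
From mathcomp Require Import all_boot all_order all_algebra.
From mathcomp Require Import all_classical all_reals all_analysis.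
From mathcomp Require Import lra.

Set Implicit Arguments.
Unset Strict Implicit.
Unset Printing Implicit Defensive.

Import Order.TTheory GRing.Theory Num.Theory.
Import numFieldNormedType.Exports.

Local Open Scope classical_set_scope.
Local Open Scope ring_scope.

(** * Cantor schemes of uncountable sets *)

Lemma uncountable_two_points (T : Type) (A B : set T) :
  ~ countable A -> countable B ->
  exists x y, [/\ A x, A y, ~ B x, ~ B y & x <> y].
Proof.
move=> Anc Bc.
have ex (D : set T) : countable D -> exists2 x, A x & ~ D x.
  move=> Dc; apply: contrapT => nex; apply: Anc.
  apply: sub_countable Dc; apply: subset_card_le => x Ax.
  by apply: contrapT => nDx; apply: nex; exists x.
have [x Ax nBx] := ex _ Bc.
have /ex[y Ay /not_orP[nBy nyx]] : countable (B `|` [set x]).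
  rewrite -bigcup2E; apply: bigcup_countable => [//|i _].
  by case: i => [|[|i]] /=; [|exact: countable1|exact: countable0].
by exists x, y; split => // xy; apply: nyx.
Qed.

Section cantor_scheme.
Context (T : Type) (nbd : nat -> T -> set T).
Hypothesis nbd_anti : forall r r' y, (r <= r')%N -> nbd r' y `<=` nbd r y.
Hypothesis nbd_base : exists2 V : set (set T), countable V &
  forall r y, exists A, [/\ V A, A y & A `<=` nbd r y].

(** The points of [S] having a neighbourhood that meets [S] in a countable set lie in [B], a
    countable union of countable sets indexed by members of [V], so two points of [S] escape it. *)
Lemma condensation_points (S : set T) : ~ countable S ->
  exists y : bool -> T, y false <> y true /\
    forall b, S (y b) /\ forall r, ~ countable (S `&` nbd r (y b)).
Proof.
move=> Snc; have [V Vc VP] := nbd_base.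
pose B := \bigcup_(A in V `&` [set A | countable (S `&` A)]) (S `&` A).
have Bc : countable B.
  apply: bigcup_countable => [|A []//].
  by apply: sub_countable Vc; apply: subset_card_le => A [].
have [x [y [Sx Sy nBx nBy xy]]] := uncountable_two_points Snc Bc.
have condP z : S z -> ~ B z -> forall r, ~ countable (S `&` nbd r z).
  move=> Sz nBz r rc; apply: nBz.
  have [A [VA Az Ar]] := VP r z; exists A => //; split=> //=.
  by apply: sub_countable rc; apply: subset_card_le; exact: setIS.
exists (fun b => if b then y else x); split=> // -[]; split=> //; exact: condP.
Qed.

(** [P n] is the separation demanded of distinct pieces at level [n]. [P_irr] forces such pieces to
    be disjoint; [P_loc] provides the separation near any two distinct points of [Y]. *)
Context (Y : set T) (P : nat -> set T -> set T -> Prop).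
Hypothesis Y_uncountable : ~ countable Y.
Hypothesis P_anti : forall n A A' B B', A `<=` A' -> B `<=` B' ->
  P n A' B' -> P n A B.
Hypothesis P_irr : forall n x, ~ P n [set x] [set x].
Hypothesis P_loc : forall n x y, Y x -> Y y -> x <> y ->
  exists r, P n (Y `&` nbd r x) (Y `&` nbd r y).

Let inv n (S : seq bool -> set T) :=
  (forall s, size s = n -> ~ countable (S s) /\ S s `<=` Y) /\
  (forall s t x, size s = n -> size t = n -> S s x -> S t x -> s = t).

Let P_disj n A B x : P n A B -> A x -> ~ B x.
Proof.
move=> PAB Ax Bx; apply: (@P_irr n x); apply: P_anti PAB => _ -> //.
Qed.

(* Words are read backwards: the two children of [s] are [b :: s]. *)
Let refines n (S S' : seq bool -> set T) :=
  [/\ inv n.+1 S',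
      forall b s, size s = n -> S' (b :: s) `<=` S s,
      forall s, size s = n.+1 -> exists y, S' s `<=` nbd n.+1 y &
      forall s t, size s = n.+1 -> size t = n.+1 -> s <> t ->
        P n.+1 (S' s) (S' t)].

(** Each piece is split at two condensation points. Disjointness of the pieces makes all these
    points distinct, so [P_loc] applies to every pair, and finitely many pairs admit one common
    radius [r]. *)
Let refine n S : inv n S -> exists S', refines n S S'.
Proof.
move=> [Sunc Sdisj].
have : forall s, exists y : bool -> T, size s = n -> y false <> y true /\
    forall b, S s (y b) /\ forall r, ~ countable (S s `&` nbd r (y b)).
  move=> s; have [/eqP sn|/eqP sn] := boolP (size s == n).
    by have [/condensation_points[y yP] _] := Sunc _ sn; exists y.
  (* For words of other lengths any value will do; the word [nseq n true] supplies one. *)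
  have [/condensation_points[y _] _] := Sunc (nseq n true) (size_nseq _ _).
  by exists y => /sn.
move=> /choice[y yP].
pose pt (s : seq bool) := y (behead s) (head true s).
have szb (s : seq bool) : size s = n.+1 -> size (behead s) = n.
  by rewrite size_behead => ->.
have ptS s : size s = n.+1 -> S (behead s) (pt s).
  by case: s => // b s [] /yP[_ /(_ b)[]].
have ptY s : size s = n.+1 -> Y (pt s).
  move=> sn; have [_] := Sunc _ (szb _ sn); apply.
  exact: ptS.
have pt_inj s t : size s = n.+1 -> size t = n.+1 -> s <> t -> pt s <> pt t.
  move=> sn tn st e; apply: st.
  have bst : behead s = behead t.
    apply: (Sdisj _ _ (pt s)); rewrite ?szb//; first exact: ptS.
    by rewrite e; exact: ptS.
  case: s t sn tn bst e => [//|b s] [//|b' t] /= [sn] _ <-; rewrite /pt/=.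
  by case: b b' => -[] // e; have [+ _] := yP s sn; rewrite e.
(* Words of length n+1 are taken as tuples, a finite type, so that [filter_forall] combines the
   radii of all pairs. *)
have [r [rn rP]] : exists r, (n.+1 <= r)%N /\ forall s t : n.+1.-tuple bool,
    val s <> val t ->
    P n.+1 (Y `&` nbd r (pt s)) (Y `&` nbd r (pt t)).
  have : \forall r \near \oo, forall st : n.+1.-tuple bool * n.+1.-tuple bool,
      val st.1 <> val st.2 ->
      P n.+1 (Y `&` nbd r (pt st.1)) (Y `&` nbd r (pt st.2)).
    apply: filter_forall => -[s t] /=.
    have [->|/eqP st] := eqVneq (val s) (val t); first by apply: nearW => ? [].
    have [r0 r0P] := P_loc n.+1 (ptY s (size_tuple s)) (ptY t (size_tuple t))
      (pt_inj _ _ (size_tuple s) (size_tuple t) st).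
    exists r0 => // r /= r0r _; apply: P_anti r0P; apply: setIS;
      exact: nbd_anti.
  move=> rP; have [r [rn {}rP]] := filter_ex (filterI (nbhs_infty_ge n.+1) rP).
  by exists r; split=> // s t; apply: (rP (s, t)).
pose S' s := S (behead s) `&` nbd r (pt s).
have S'Y s : size s = n.+1 -> S' s `<=` Y `&` nbd r (pt s).
  move=> sn; apply: setSI.
  by have [] := Sunc _ (szb _ sn).
have PS' s t : size s = n.+1 -> size t = n.+1 -> s <> t -> P n.+1 (S' s) (S' t).
  move=> sn tn;
  have /= := rP (Tuple (introT eqP sn)) (Tuple (introT eqP tn)).
  by move=> /[apply]; apply: P_anti; exact: S'Y.
exists S'; split => //.
- split=> [s sn|s t x sn tn S's S't]; last first.
    by apply: contrapT => /(PS' _ _ sn tn) /P_disj /(_ S's).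
  split; last by move=> x /(S'Y _ sn)[].
  by case: s sn => // b s [sn]; have [_ /(_ b)[_]] := yP _ sn; apply.
- by move=> b s _ x [].
- move=> s _; exists (pt s) => x [_]; exact: nbd_anti.
Qed.

Lemma cantor_scheme : exists S : seq bool -> set T,
  [/\ forall s, S s !=set0 /\ S s `<=` Y,
      forall b s, S (b :: s) `<=` S s,
      forall s, s != [::] -> exists y, S s `<=` nbd (size s) y &
      forall s t, size s = size t -> s <> t -> P (size s) (S s) (S t)].
Proof.
have /choice[step stepP] : forall nS : nat * (seq bool -> set T),
    exists S', inv nS.1 nS.2 -> refines nS.1 nS.2 S'.
  move=> [n S]; have [i|ni] := pselect (inv n S); last by exists S.
  by have [S' S'P] := refine i; exists S'.
pose F := fix F n := if n is m.+1 then step (m, F m) else fun=> Y.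
have invF n : inv n (F n).
  elim: n => [|n /(stepP (n, _))[]//].
  split=> [s _|s t x /size0nil -> /size0nil ->]; last by [].
  by split=> //; exact: Y_uncountable.
have FP n : refines n (F n) (F n.+1) by exact: (stepP (n, _)).
exists (fun s => F (size s) s); split.
- move=> s; have [/(_ s erefl)[unc sY] _] := invF (size s); split => //.
  by apply/set0P/negP => /eqP F0; apply: unc; rewrite F0.
- by move=> b s; have [_ /(_ b s erefl)] := FP (size s).
- by case=> // b s _; have [_ _ /(_ (b :: s) erefl)] := FP (size s).
- move=> [|b s] [|b' t]//= [est] ne; rewrite -est.
  by have [_ _ _ /(_ (b :: s) (b' :: t) erefl)] := FP (size s);
    apply=> //=; rewrite est.
Qed.

End cantor_scheme.

(** * The limit map of a Cantor scheme in a complete space *)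

Section cantor_limit.
Context (R : realType) (X : metricType R) (C : countType) (c : X -> nat -> C).
Hypothesis X_complete : complete_space X.
Hypothesis X_separable : separable_space X.

(** Basic neighbourhoods of the coarsest refinement of the metric topology in which every code is
    locally constant; they need not be open in [X]. *)
Definition coded_nbd (r : nat) (y : X) : set X :=
  [set z | mdist y z < r.+1%:R^-1 /\ forall k, (k < r)%N -> c z k = c y k].

Lemma coded_nbd_anti r r' y : (r <= r')%N -> coded_nbd r' y `<=` coded_nbd r y.
Proof.
move=> rr' z [yz cz]; split=> [|k kr]; last exact/cz/(leq_trans kr).
by apply: lt_le_trans yz _; rewrite lef_pV2 ?posrE// ler_nat.
Qed.

(** Halving the radius leaves room to move the centre into the dense set [D], and there are only
    countably many finite lists of codes. *)
Lemma coded_nbd_base : exists2 V : set (set X), countable V &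
  forall r y, exists A, [/\ V A, A y & A `<=` coded_nbd r y].
Proof.
have [D Dc Dd] := X_separable.
pose F (p : X * (nat * seq C)) := [set z | mdist p.1 z < (p.2.1.+1%:R^-1) / 2 /\
  map (c z) (iota 0 p.2.1) = p.2.2].
exists (F @` (D `*` setT)).
  by apply: sub_countable (card_image_le _ _) _; exact: countableX.
move=> r y; have e0 : 0 < r.+1%:R^-1 / 2 :> R by rewrite divr_gt0// invr_gt0.
have [q [yq Dq]] : (ball y (r.+1%:R^-1 / 2))^° `&` D !=set0.
  apply: Dd; last exact: open_interior.
  by exists y; exact: nbhsx_ballx.
move/interior_subset: yq; rewrite ballEmdist/= => yq.
exists (F (q, (r, map (c y) (iota 0 r)))); split.
- by exists (q, (r, map (c y) (iota 0 r))).
- by split; rewrite //= metric_sym.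
- move=> z [/= qz cz]; split=> [|k kr].
    by rewrite (le_lt_trans (metric_triangle y q z))// [ltRHS]splitr ltrD.
  have /(congr1 (fun s => nth (c z 0) s k)) := cz.
  by rewrite !(nth_map 0%N) ?size_iota// nth_iota.
Qed.

(** Turns an open condition at a point into one on closures of small pieces, hence on limit points.
    Half of [e] is spent on the piece and half on its closure. *)
Lemma closure_coded_nbd x U : nbhs x U -> \forall r \near \oo,
  forall A, A `<=` coded_nbd r x -> closure A `<=` U.
Proof.
move=> /nbhs_ballP[e /= e0 eU].
have e20 : 0 < e / 2 by rewrite divr_gt0.
have [r _ rP] := near_infty_natSinv_lt (PosNum e20).
exists r => // r' /rP/= r'e A Ax z /(_ _ (nbhsx_ballx z _ e20))[w [/Ax[xw _]]].
rewrite ballEmdist/= metric_sym => wz; apply: eU; rewrite ballEmdist/=.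
by have := metric_triangle x w z; have := lt_trans xw r'e; lra.
Qed.

(** Going through [y] costs 2e inside [A], and approximating each of the two closure points costs
    one more [e]. *)
Lemma closure_mdist (A : set X) (y x x' : X) (e : R) : 0 < e ->
  A `<=` [set z | mdist y z < e] -> closure A x -> closure A x' ->
  mdist x x' < 4 * e.
Proof.
move=> e0 Ae Ax Ax'.
have [z [/Ae/= yz]] := Ax _ (nbhsx_ballx x e e0).
have [z' [/Ae/= yz']] := Ax' _ (nbhsx_ballx x' e e0).
rewrite !ballEmdist/= => xz' xz.
have := metric_triangle x z x'; have := metric_triangle z y x'.
have := metric_triangle y z' x'; rewrite (metric_sym z') (metric_sym z y); lra.
Qed.

(** The latest bit comes first, as in the words of the scheme. *)
Fixpoint prefix (a : cantor_space) n : seq bool :=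
  if n is m.+1 then a m :: prefix a m else [::].

Lemma size_prefix a n : size (prefix a n) = n.
Proof. by elim: n => //= n ->. Qed.

Lemma near_prefix a n : \forall b \near a, prefix b n = prefix a n.
Proof.
elim: n => [|n IHn] /=; first by apply: filterE.
have an : \forall b \near a, b n = a n.
  exact: (@proj_continuous _ (fun _ : nat => bool) n a _ (discrete_set1 (a n))).
by apply: filterS2 IHn an => b -> ->.
Qed.

Lemma prefix_neq a b : a <> b ->
  exists N, forall n, (N <= n)%N -> prefix a n <> prefix b n.
Proof.
move=> ab; have [k abk] : exists k, a k <> b k.
  apply: contrapT => nex; apply: ab; apply/funext => k.
  by apply: contrapT => abk; apply: nex; exists k.
exists k.+1; elim=> // n IHn; rewrite leq_eqVlt => /predU1P[[<-]|kn] /= [].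
  by move=> /abk.
by move=> _; exact: IHn.
Qed.

Context (Y : set X) (P : nat -> set X -> set X -> Prop).
Hypothesis Y_uncountable : ~ countable Y.
Hypothesis P_anti : forall n A A' B B', A `<=` A' -> B `<=` B' ->
  P n A' B' -> P n A B.
Hypothesis P_irr : forall n x, ~ P n [set x] [set x].
Hypothesis P_loc : forall n x y, Y x -> Y y -> x <> y ->
  exists r, P n (Y `&` coded_nbd r x) (Y `&` coded_nbd r y).

(** [h a] is the limit of points picked along the branch [a]. The pieces [S a n] are returned as
    well because codes need not be continuous: the members of a piece share them, its limit point
    may not. *)
Lemma cantor_limit :
  exists (h : cantor_space -> X) (S : cantor_space -> nat -> set X),
  [/\ continuous h,
      forall a n, S a n !=set0 /\ S a n `<=` Y,
      forall a m n, (m <= n)%N -> S a n `<=` S a m,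
      forall a n, closure (S a n) (h a) &
      (forall a n k z z', (k < n)%N -> S a n z -> S a n z' -> c z k = c z' k) /\
      forall a b, a <> b ->
        exists N, forall n, (N <= n)%N -> P n (S a n) (S b n)].
Proof.
have [S [SY Ssub Snbd SP]] :=
  cantor_scheme coded_nbd_anti coded_nbd_base Y_uncountable P_anti P_irr P_loc.
have Snest a m n : (m <= n)%N -> S (prefix a n) `<=` S (prefix a m).
  elim: n => [|n IHn]; first by rewrite leqn0 => /eqP ->.
  rewrite leq_eqVlt => /predU1P[-> //|/IHn]; apply: subset_trans; exact: Ssub.
have Sn a n : exists y, S (prefix a n.+1) `<=` coded_nbd n.+1 y.
  by have /= := Snbd (prefix a n.+1) isT; rewrite size_prefix.
have /choice[u uS] : forall an : cantor_space * nat,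
    exists x, S (prefix an.1 an.2) x.
  by move=> [a n]; have [] := SY (prefix a n).
(* The piece at depth n+1 lies in a ball of radius 1/(n+2), whence the shift by two. *)
have small e : 0 < e -> exists n, n.+2%:R^-1 < e :> R.
  move=> e0; have [n _ nP] := near_infty_natSinv_lt (PosNum e0).
  by exists n; apply: (nP n.+1); exact: leqnSn.
have /choice[h hlim] : forall a : cantor_space, exists x : X,
    (fun n => u (a, n)) @ \oo --> x.
  move=> a; apply: X_complete; apply/cauchyP => e /small[n ne].
  have [y Sy] := Sn a n; exists y; exists n.+1 => // m /= nm.
  have /Sy[+ _] := Snest a _ _ nm _ (uS (a, m)).
  by rewrite ballEmdist/= => /lt_trans; apply.
have hcl a n : closure (S (prefix a n)) (h a).
  move=> B /hlim hB.
  have [m [nm Bm]] := filter_ex (filterI (nbhs_infty_ge n) hB).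
  exists (u (a, m)); split => //.
  by apply: (Snest a _ _ nm); exact: (uS (a, m)).
exists h, (fun a n => S (prefix a n)); split => //.
(* Sequences near [a] share its prefix of length n+1, so their images lie in the closure of one
   small piece. *)
- move=> a; apply/(@metricType_numDomainType.cvgrPdist_lt R X) => e e0.
  have [|n ne] := small (e / 4); first by rewrite divr_gt0.
  near=> b; have [y Sy] := Sn a n.
  apply: (@lt_le_trans _ _ (4 * n.+2%:R^-1)); last first.
    by rewrite mulrC -ler_pdivlMr// ltW.
  apply: (closure_mdist (A := S (prefix a n.+1)) (y := y)) => //.
  + by move=> z /Sy[].
  + have <- : prefix b n.+1 = prefix a n.+1 by near: b; exact: near_prefix.
    exact: hcl.
- split=> [a [//|n] k z z' kn|a b /prefix_neq[N NP]].
    by have [y Sy] := Sn a n; move=> /Sy[_ ->// ] /Sy[_ ->].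
  exists N => n /NP /SP; rewrite !size_prefix; exact.
Unshelve. all: by end_near. Qed.

End cantor_limit.

(** * Proximality and asymptoticity through orbit distances *)

Section orbits.
Context (R : realType) (X : metricType R) (f : X -> X).

Local Notation dist m x y := (mdist (iter m f x) (iter m f y)).

(** Lies between limsup > e and limsup >= e. For continuous [f], the strict inequality makes the
    condition at each [n] open in the pair. *)
Definition apart (e : R) (x y : X) :=
  forall n, exists2 m, (n <= m)%N & e < dist m x y.

(** One parameter bounds both time and tolerance, so a single sequence of conditions describes
    proximality. *)
Definition close_after n (x y : X) :=
  exists2 m, (n <= m)%N & dist m x y < n.+1%:R^-1.

Lemma proximalP x y : proximal f x y <-> forall n, close_after n x y.
Proof.
have -> : proximal f x y = (limf_einf (orbit_dist f x y) \oo = 0%E) by [].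
rewrite limf_einfE; split=> [inf0 n|close].
- apply: contrapT => nclose.
  suff : ((n.+1%:R^-1)%:E <= 0 :> \bar R)%E.
    by rewrite lee_fin leNgt invr_gt0 ltr0Sn.
  rewrite -inf0; apply: le_ereal_sup_tmp.
  exists (ereal_inf (orbit_dist f x y @` [set m | (n <= m)%N])).
    by exists [set m | (n <= m)%N] => //; exact: nbhs_infty_ge.
  apply: le_ereal_inf_tmp => _ [m /= nm <-]; rewrite lee_fin leNgt.
  by apply/negP => mn; apply: nclose; exists m.
- apply/eqP; rewrite eq_le; apply/andP; split; last first.
    apply: le_ereal_sup_tmp; exists (ereal_inf (orbit_dist f x y @` setT)).
      by exists setT => //; exact: filterT.
    by apply: le_ereal_inf_tmp => _ [m _ <-]; rewrite lee_fin mdist_ge0.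
  apply: ge_ereal_sup => _ [V [N _ NV] <-].
  apply/lee_addgt0Pr => e e0; rewrite add0e.
  have [n _ nP] := near_infty_natSinv_lt (PosNum e0).
  have [m nm dm] := close (maxn n N).
  apply: ge_ereal_inf; exists (orbit_dist f x y m).
    by exists m => //; apply: NV; exact: leq_trans (leq_maxr _ _) nm.
  rewrite lee_fin ltW// (lt_trans dm)//; apply: (nP (maxn n N)).
  exact: leq_maxl.
Qed.

Lemma not_asymptoticP x y :
  ~ asymptotic f x y <-> exists2 e, 0 < e & apart e x y.
Proof.
have -> : asymptotic f x y = (limf_esup (orbit_dist f x y) \oo = 0%E) by [].
split=> [nasym|[e e0 exy] asym].
- apply: contrapT => napart; apply: nasym; apply/eqP; rewrite eq_le.
  apply/andP; split; last first.
    apply: limf_esup_ge0 => [|m]; first exact: filter_not_empty.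
    by rewrite lee_fin mdist_ge0.
  apply/lee_addgt0Pr => e e0; rewrite add0e limf_esupE.
  have [N NP] : exists N, forall m, (N <= m)%N -> dist m x y <= e.
    apply: contrapT => nN; apply: napart; exists e => // N.
    apply: contrapT => nm; apply: nN; exists N => m Nm.
    by rewrite leNgt; apply/negP => em; apply: nm; exists m.
  apply: ge_ereal_inf.
  exists (ereal_sup (orbit_dist f x y @` [set m | (N <= m)%N])).
    by exists [set m | (N <= m)%N] => //; exact: nbhs_infty_ge.
  by apply: ge_ereal_sup => _ [m /= /NP Nm <-]; rewrite lee_fin.
- have : (limf_esup (orbit_dist f x y) \oo < e%:E)%E by rewrite asym lte_fin.
  rewrite limf_esupE => /ereal_inf_lt[_ [V [N _ NV] <-]]; apply/negP.
  have [m Nm em] := exy N; rewrite -leNgt; apply: le_ereal_sup_tmp.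
  exists (orbit_dist f x y m); last by rewrite lee_fin ltW.
  by exists m => //; exact: NV.
Qed.

Lemma apart_irr e x : 0 <= e -> ~ apart e x x.
Proof. by move=> e0 /(_ 0%N)[m _]; rewrite mdistxx ltNge e0. Qed.

Lemma apart_le e e' x y : e' <= e -> apart e x y -> apart e' x y.
Proof.
move=> ee' xy n; have [m nm em] := xy n; exists m => //.
exact: le_lt_trans em.
Qed.

Lemma not_apart e x y : ~ apart e x y ->
  exists N, forall m, (N <= m)%N -> dist m x y <= e.
Proof.
move=> /existsNP[N nN]; exists N => m Nm; rewrite leNgt; apply/negP => em.
by apply: nN; exists m.
Qed.

(** The triangle inequality on a common tail. It serves to pass from points to nearby net points and
    back. *)
Lemma apart_near e e1 e2 x y x' y' N N' : apart e x y ->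
  (forall m, (N <= m)%N -> dist m x x' <= e1) ->
  (forall m, (N' <= m)%N -> dist m y y' <= e2) ->
  apart (e - e1 - e2) x' y'.
Proof.
move=> exy xx' yy' n; have [m] := exy (maxn n (maxn N N')).
rewrite !geq_max => /andP[nm /andP[/xx' xm /yy' ym]] em; exists m => //.
have := metric_triangle (iter m f x) (iter m f x') (iter m f y).
have := metric_triangle (iter m f x') (iter m f y') (iter m f y).
by rewrite (metric_sym (iter m f y')); lra.
Qed.

Lemma apart_sym e x y : apart e x y -> apart e y x.
Proof.
by move=> xy n; have [m nm] := xy n; exists m; rewrite // metric_sym.
Qed.

(** By Zorn: a point apart from all of a maximal [D] could be added to it, and would be new since no
    point is apart from itself. *)
Lemma maximal_apart e (Y : set X) : 0 <= e -> exists D, [/\ D `<=` Y,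
  forall x y, D x -> D y -> x <> y -> apart e x y &
  forall y, Y y -> exists2 d, D d & ~ apart e y d].
Proof.
move=> e0.
pose Q (D : set X) := D `<=` Y /\
  forall x y, D x -> D y -> x <> y -> apart e x y.
have [F FQ Ftot|D [[DY Dap] Dmax]] := @Zorn_bigcup X Q.
  split=> [x [A /FQ[AY _] Ax]|x y [A FA Ax] [B FB By]]; first exact: AY.
  have [AB|BA] := Ftot _ _ FA FB.
    by have [_] := FQ _ FB; apply => //; exact: AB.
  by have [_] := FQ _ FA; apply => //; exact: BA.
exists D; split => // y Yy; apply: contrapT => ny.
have yap d : D d -> apart e y d.
  by move=> Dd; apply: contrapT => nyd; apply: ny; exists d.
apply: (Dmax (D `|` [set y])).
  split=> [x|sub]; first by left.
  by have /yap/apart_irr := sub y (or_intror erefl); exact.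
split=> [x [/DY//|->//]|x z [Dx|->] [Dz|->]].
- exact: Dap.
- by move=> _; apply: apart_sym; exact: yap.
- by move=> _; exact: yap.
- by [].
Qed.

Hypothesis f_continuous : continuous f.

Lemma iter_continuous m : continuous (iter m f).
Proof.
elim: m => [|m IHm] x /=; first exact: cvg_id.
by apply: (@continuous_comp _ _ _ (iter m f) f);
  [exact: IHm|exact: f_continuous].
Qed.

Lemma dist_iter_near m x y e : 0 < e -> exists U V, [/\ nbhs x U, nbhs y V &
  forall z w, U z -> V w -> dist m x y - e < dist m z w < dist m x y + e].
Proof.
move=> e0; have e20 : 0 < e / 2 by rewrite divr_gt0.
exists (iter m f @^-1` ball (iter m f x) (e / 2)).
exists (iter m f @^-1` ball (iter m f y) (e / 2)); split.
- by apply: iter_continuous; exact: nbhsx_ballx.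
- by apply: iter_continuous; exact: nbhsx_ballx.
- move=> z w; rewrite !ballEmdist/= => xz yw.
  have := metric_triangle (iter m f z) (iter m f x) (iter m f w).
  have := metric_triangle (iter m f x) (iter m f y) (iter m f w).
  have := metric_triangle (iter m f x) (iter m f z) (iter m f y).
  have := metric_triangle (iter m f z) (iter m f w) (iter m f y).
  rewrite (metric_sym (iter m f z) (iter m f x)).
  rewrite (metric_sym (iter m f w) (iter m f y)).
  by move=> ? ? ? ?; apply/andP; split; lra.
Qed.

Lemma closure_dist_le m (A : set X) x y e :
  (forall z, A z -> dist m z y <= e) -> closure A x -> dist m x y <= e.
Proof.
move=> Ae Ax; rewrite leNgt; apply/negP => exy.
have [|U [V [xU yV UV]]] := dist_iter_near m x y (e := dist m x y - e).
  by rewrite subr_gt0.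
have [z [/Ae ze Uz]] := Ax _ xU.
by have := UV _ _ Uz (nbhs_singleton yV); lra.
Qed.

End orbits.

(** * Embedded copies of Cantor space *)

Lemma cantor_set_range (R : realType) (X : metricType R)
    (h : cantor_space -> X) :
  continuous h -> injective h -> cantor_set (range h).
Proof.
move=> hc hinj.
have hP (x : set_type (range h)) : exists a, h a = set_val x.
  by have [a _ ax] := set_mem (valP x); exists a.
pose k x := projT1 (cid (hP x)).
have kE x : h (k x) = set_val x by rewrite /k; case: cid.
pose g a : set_type (range h) := SigSub (mem_set (imageT h a)).
have gE a : set_val (g a) = h a by [].
exists k, g; split.
- by move=> x; apply: val_inj; rewrite /= kE.
- by move=> a; apply: hinj; rewrite kE.
(* Continuity of the inverse: a closed set of Cantor space is compact, so its image under [h] is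
   compact and thus closed in the Hausdorff space [X]. *)
- apply/continuous_closedP => A Acl.
  have -> : k @^-1` A = set_val @^-1` (h @` A).
    apply/seteqP; split=> x /=; first by exists (k x).
    by move=> [a Aa ax]; have -> : k x = a by apply: hinj; rewrite kE.
  have /continuous_closedP :=
    @initial_continuous (set_type (range h)) X set_val.
  apply; apply: compact_closed; first exact: metric_hausdorff.
  apply: continuous_compact; first exact: continuous_subspaceT.
  apply: (@subclosed_compact _ _ [set: cantor_space]) => //.
  exact: cantor_space_compact.
- exact: continuous_comp_initial.
Qed.

(** * Scrambled Cantor sets in the uniform and the countable-net case *)

Section cantor_scrambled.
Context (R : realType) (X : metricType R) (f : X -> X).
Hypothesis X_complete : complete_space X.
Hypothesis X_separable : separable_space X.
Hypothesis f_continuous : continuous f.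

(** Injectivity comes for free: equal images would form a Li--Yorke pair, yet a point is asymptotic
    to itself. *)
Lemma scrambled_range (h : cantor_space -> X) : continuous h ->
  (forall a b, a <> b -> li_yorke_pair f (h a) (h b)) ->
  exists C : set X, scrambled f C /\ cantor_set C.
Proof.
move=> hc hLY; exists (range h); split.
  by move=> _ _ [a _ <-] [b _ <-] hab; apply: hLY => ab; apply: hab; rewrite ab.
apply: cantor_set_range => // a b hab; apply: contrapT => /hLY[_].
by rewrite hab => /not_asymptoticP[e e0]; apply: apart_irr; exact: ltW.
Qed.

Lemma near_close_after n x y : close_after f n x y ->
  exists U V, [/\ nbhs x U, nbhs y V &
    forall z w, U z -> V w -> close_after f n z w].
Proof.
move=> [m nm dm].
have [|U [V [xU yV UV]]] := dist_iter_near f_continuous m x y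
  (e := n.+1%:R^-1 - mdist (iter m f x) (iter m f y));
  first by rewrite subr_gt0.
exists U, V; split=> // z w /UV /[apply] /andP[_]; rewrite addrC subrK => zw.
by exists m.
Qed.

Lemma near_far m e x y : e < mdist (iter m f x) (iter m f y) ->
  exists U V, [/\ nbhs x U, nbhs y V &
    forall z w, U z -> V w -> e < mdist (iter m f z) (iter m f w)].
Proof.
move=> em.
have [|U [V [xU yV UV]]] := dist_iter_near f_continuous m x y
  (e := mdist (iter m f x) (iter m f y) - e); first by rewrite subr_gt0.
by exists U, V; split=> // z w /UV /[apply] /andP[+ _]; rewrite subKr.
Qed.

(** With one [e] for all pairs, every condition is open and trivial codes suffice. [P] speaks of
    closures so that it can be read off at the limit points. *)
Lemma scrambled_of_apart e (Y : set X) : 0 < e -> ~ countable Y ->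
  scrambled f Y -> (forall x y, Y x -> Y y -> x <> y -> apart f e x y) ->
  exists C : set X, scrambled f C /\ cantor_set C.
Proof.
move=> e0 Ync Yscr Yap; pose c (_ : X) (_ : nat) := tt.
pose far n x y := exists2 m, (n <= m)%N & e < mdist (iter m f x) (iter m f y).
pose P n A B := forall z w, closure A z -> closure B w ->
  close_after f n z w /\ far n z w.
have [|||h [S [hc _ _ hcl [_ SP]]]] :=
    cantor_limit (c := c) X_complete X_separable (Y := Y) (P := P) Ync.
- move=> n A A' B B' AA' BB' PAB z w Az Bw.
  by apply: PAB; [apply: closure_subset Az|apply: closure_subset Bw].
- move=> n x /(_ x x)[||_ [m _]]; try exact: subset_closure.
  by rewrite mdistxx ltNge ltW.
- move=> n x y Yx Yy xy; have [/proximalP/(_ n) xyc _] := Yscr _ _ Yx Yy xy.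
  have [U [V [xU yV UV]]] := near_close_after xyc.
  have [m nm /near_far[U' [V' [xU' yV' UV']]]] := Yap _ _ Yx Yy xy n.
  have [r [[rU rV] [rU' rV']]] := filter_ex (filterI
    (filterI (closure_coded_nbd c xU) (closure_coded_nbd c yV))
    (filterI (closure_coded_nbd c xU') (closure_coded_nbd c yV'))).
  exists r => z w cz cw; split.
    by apply: UV; [apply: rU cz|apply: rV cw]; exact: subIsetr.
  by exists m => //; apply: UV'; [apply: rU' cz|apply: rV' cw]; exact: subIsetr.
apply: (scrambled_range hc) => a b /SP[N NP].
have hab n : close_after f (maxn n N) (h a) (h b) /\ far (maxn n N) (h a) (h b).
  by apply: (NP (maxn n N) (leq_maxr _ _)); exact: hcl.
split.
  apply/proximalP => n; have [[m nm dm] _] := hab n.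
  exists m; first exact: leq_trans (leq_maxl _ _) nm.
  by apply: lt_le_trans dm _; rewrite lef_pV2 ?posrE// ler_nat ltnS leq_maxl.
apply/not_asymptoticP; exists e => // n; have [_ [m nm dm]] := hab n.
by exists m => //; exact: leq_trans (leq_maxl _ _) nm.
Qed.

(* The nearby points [p z k], together with the times from which they are near,
   are the codes: they are constant on small sets of the scheme, so that limit
   points inherit them. *)
Lemma scrambled_of_countable_nets (D : nat -> set X) (Y : set X) :
  ~ countable Y -> scrambled f Y -> (forall k, countable (D k)) ->
  (forall k y, Y y -> exists2 d, D k d & ~ apart f k.+1%:R^-1 y d) ->
  exists C : set X, scrambled f C /\ cantor_set C.
Proof.
move=> Ync Yscr Dc Dnet.
have e0 k : 0 < k.+1%:R^-1 :> R by rewrite invr_gt0.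
have /choice[g gP] k : exists g : X -> nat, {in D k &, injective g}.
  exact/countable_injP.
have /choice[q qP] : forall yk : X * nat, exists q : X * nat, Y yk.1 ->
    D yk.2 q.1 /\ forall m, (q.2 <= m)%N ->
      mdist (iter m f yk.1) (iter m f q.1) <= yk.2.+1%:R^-1.
  move=> [y k] /=; have [Yy|nYy] := pselect (Y y); last by exists (y, 0%N).
  have [d Dd /not_apart[N NP]] := Dnet k y Yy.
  by exists (d, N).
pose p z k := (q (z, k)).1; pose N z k := (q (z, k)).2.
(* [g k] numbers the points of [D k], so that the codes live in a countable type. *)
pose c z k : nat * nat := (g k (p z k), N z k).
have pE z w k : Y z -> Y w -> c z k = c w k -> p z k = p w k /\ N z k = N w k.
  move=> /(qP (z, k))[Dz _] /(qP (w, k))[Dw _] [gzw ->]; split=> //.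
  by apply: (gP k); rewrite ?inE.
(* Apartness is asked of the net points over the pieces themselves, as codes may change on closures.
   Starting from e > 5/(k+1), passing to net points loses 2/(k+1) and leaves 3/(k+1); passing on to
   limit points loses 2/(k+1) again and leaves 1/(k+1). *)
pose P n A B :=
  (forall z w, closure A z -> closure B w -> close_after f n z w) /\
  exists k, forall z w, A z -> B w -> apart f (3 * k.+1%:R^-1) (p z k) (p w k).
have [|||h [S [hc SY Snest hcl [Sc SP]]]] :=
    cantor_limit (c := c) X_complete X_separable (Y := Y) (P := P) Ync.
- move=> n A A' B B' AA' BB' [PAB [k kAB]]; split.
    move=> z w Az Bw.
    by apply: PAB; [apply: closure_subset Az|apply: closure_subset Bw].
  by exists k => z w /AA' Az /BB'; exact: kAB.
- move=> n x [_ [k /(_ x x erefl erefl)]]; apply: apart_irr.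
  by rewrite mulr_ge0// ltW.
- move=> n x y Yx Yy xy.
  have [/proximalP/(_ n) xyc /not_asymptoticP[e ep exy]] := Yscr _ _ Yx Yy xy.
  have [U [V [xU yV UV]]] := near_close_after xyc.
  have e50 : 0 < e / 5 by rewrite divr_gt0.
  have [k _ /(_ k (leqnn k))/= ke] := near_infty_natSinv_lt (PosNum e50).
  have [r [[rU rV] kr]] := filter_ex (filterI
    (filterI (closure_coded_nbd c xU) (closure_coded_nbd c yV))
    (nbhs_infty_ge k.+1)).
  exists r; split=> [z w cz cw|].
    by apply: UV; [apply: rU cz|apply: rV cw]; exact: subIsetr.
  exists k => z w [Yz [_ /(_ k kr) /(pE _ _ _ Yz Yx)[-> _]]].
  move=> [Yw [_ /(_ k kr) /(pE _ _ _ Yw Yy)[-> _]]].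
  have [_ xp] := qP (x, k) Yx; have [_ yp] := qP (y, k) Yy.
  by apply: apart_le (apart_near exy xp yp); move: (k.+1%:R^-1) ke => t /=; lra.
(* All members of [S a n] share with [z] the net point and the time [N z k], so the bound holds for
   all of them from one time on and passes to the closure. *)
have hp a k n z : (k < n)%N -> S a n z -> forall m, (N z k <= m)%N ->
    mdist (iter m f (h a)) (iter m f (p z k)) <= k.+1%:R^-1.
  move=> kn Sz m Nm; apply: (closure_dist_le f_continuous _ (hcl a n)) => w Sw.
  have [_ SnY] := SY a n; have [<- NE] := pE _ _ _ (SnY _ Sw) (SnY _ Sz)
    (Sc _ _ _ _ _ kn Sw Sz).
  by have [_] := qP (w, k) (SnY _ Sw); apply; rewrite -/(N w k) NE.
apply: (scrambled_range hc) => a b /SP[M MP]; split.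
  apply/proximalP => n; have [Pc _] := MP (maxn n M) (leq_maxr _ _).
  have [m nm dm] := Pc _ _ (hcl a _) (hcl b _).
  exists m; first exact: leq_trans (leq_maxl _ _) nm.
  by apply: lt_le_trans dm _; rewrite lef_pV2 ?posrE// ler_nat ltnS leq_maxl.
apply/not_asymptoticP; have [_ [k kP]] := MP M (leqnn _).
(* This depth is at least [M], so that [kP] applies, and exceeds [k], so that the code at [k] is
   constant on each piece. *)
have [[z Sz] _] := SY a (maxn M k.+1); have [[w Sw] _] := SY b (maxn M k.+1).
have kM : (k < maxn M k.+1)%N by exact: leq_maxr.
have zw := kP z w (Snest _ _ _ (leq_maxl _ _) _ Sz)
  (Snest _ _ _ (leq_maxl _ _) _ Sw).
exists k.+1%:R^-1 => //; apply: apart_le (apart_near (N := N z k) (N' := N w k)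
    (e1 := k.+1%:R^-1) (e2 := k.+1%:R^-1) zw _ _).
- by move: (k.+1%:R^-1) => t; lra.
- by move=> m Nm; rewrite metric_sym; exact: hp kM Sz _ Nm.
- by move=> m Nm; rewrite metric_sym; exact: hp kM Sw _ Nm.
Qed.

End cantor_scrambled.

(** * Existence of a scrambled Cantor set *)

Theorem theorem1 (R : realType) (X : metricType R) (f : X -> X)
    (X_complete : complete_space X) (X_separable : separable_space X)
    (f_continuous : continuous f)
    (f_chaotic : li_yorke_chaotic f) :
  exists C : set X, scrambled f C /\ cantor_set C.
Proof.
have [Y Ync Yscr] := f_chaotic.
have e0 k : 0 < k.+1%:R^-1 :> R by rewrite invr_gt0.
have /choice[D DP] k := maximal_apart f Y (ltW (e0 k)).
have [Dc|/existsNP[k Dnc]] := pselect (forall k, countable (D k)).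
  apply: (scrambled_of_countable_nets X_complete X_separable f_continuous
    Ync Yscr Dc) => k y Yy.
  by have [_ _ /(_ y Yy)] := DP k.
have [DY Dap _] := DP k.
apply: (scrambled_of_apart X_complete X_separable f_continuous
  (e0 k) Dnc _ Dap).
by move=> x y /DY Yx /DY; exact: Yscr.
Qed.
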